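(* Denote by $P_{\beta,\infty}$ the minimizer of $\mathcal{E}_{\beta,\infty}(P) = \operatorname{tr}(HP) + \frac{1}{\beta}\operatorname{tr}\{P\ln P + (1-P)\ln(1-P)\}$ and by $P_{\beta,\eta}$ the minimizer of $\mathcal{E}_{\beta,\infty}(P) + \frac{1}{\eta}\|P\|_1$, both subject to $\operatorname{tr} P = N$, $P = P^{\mathrm{T}}$, $0\preceq P\preceq I$. Then $$0 \le \mathcal{E}_{\beta,\infty}(P_{\beta,\eta}) - \mathcal{E}_{\beta,\infty}(P_{\beta,\infty}) \le \frac{1}{\eta}\|P_{\beta,\infty}\|_1,$$ and $$\operatorname{tr}\Bigl(\max\bigl(\beta^{-1}, |H-\mu|\bigr)(P_{\beta,\eta} - P_{\beta,\infty})^2\Bigr) \le \frac{1}{\eta}\|P_{\beta,\infty}\|_1.$$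
   Context: $H$ is an $n\times n$ real symmetric matrix with eigenpairs $\{\lambda_i,\phi_i\}$; $N$ is a positive integer; $\beta>0$ is the inverse temperature and $\eta>0$ the $\ell_1$ penalty parameter. $\|P\|_1=\sum_{i,j}|p_{ij}|$ is the entrywise $\ell_1$ norm and $A\preceq B$ means $B-A$ is positive semidefinite. The minimizer of the unregularized problem is $P_{\beta,\infty} = [1+\exp(\beta(H-\mu))]^{-1}$, where the chemical potential $\mu$ is determined by $\sum_{i=1}^n (1+\exp(\beta(\lambda_i-\mu)))^{-1} = N$. Both problems are strictly convex so minimizers exist and are unique. $|H-\mu|$ and $\max(\beta^{-1},|H-\mu|)$ are matrix functions defined via the spectral decomposition of $H$. *)

(* Defs.v *)
From HB Require Import structures.
From mathcomp Require Import all_boot all_order all_algebra.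
From mathcomp Require Import boolp reals sequences.
From mathcomp.analysis Require Import exp.
Set Implicit Arguments. Unset Strict Implicit. Unset Printing Implicit Defensive.
Import Order.TTheory GRing.Theory Num.Theory.
Local Open Scope ring_scope.

Section Defs.
Variables (R : realType) (n : nat).

Definition spec_decomp (A U : 'M[R]_n) (d : 'rV[R]_n) : Prop :=
  U *m U^T = 1%:M /\ A = U *m diag_mx d *m U^T.

(* Matrix function f(A) defined through the spectral decomposition of A
   (a decomposition is chosen; the result does not depend on the choice).
   Only meaningful for real symmetric A; returns A otherwise. *)
Definition mxfun (f : R -> R) (A : 'M[R]_n) : 'M[R]_n :=
  match pselect (exists Ud : 'M[R]_n * 'rV[R]_n, spec_decomp A Ud.1 Ud.2) with
  | left h => let Ud := proj1_sig (cid h) in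
              Ud.1 *m diag_mx (map_mx f Ud.2) *m Ud.1^T
  | right _ => A
  end.

Definition psd (A : 'M[R]_n) : Prop :=
  forall v : 'cV[R]_n, 0 <= (v^T *m A *m v) 0 0.

Definition l1norm (P : 'M[R]_n) : R := \sum_i \sum_j `|P i j|.

(* x ln x + (1-x) ln (1-x), with 0 ln 0 = 0 (ln 0 = 0 in the library) *)
Definition binent (x : R) : R := x * ln x + (1 - x) * ln (1 - x).

Definition Ebeta (H : 'M[R]_n) (beta : R) (P : 'M[R]_n) : R :=
  \tr (H *m P) + beta^-1 * \tr (mxfun binent P).

Definition feasible (N : nat) (P : 'M[R]_n) : Prop :=
  \tr P = N%:R /\ P^T = P /\ psd P /\ psd (1%:M - P).

Definition is_minimizer (F : 'M[R]_n -> R) (N : nat) (P : 'M[R]_n) : Prop :=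
  feasible N P /\ forall Q, feasible N Q -> F P <= F Q.

Definition fermi (beta mu x : R) : R := (1 + expR (beta * (x - mu)))^-1.

End Defs.

(* Main.v *)
Require Import Defs.
From HB Require Import structures.
From mathcomp Require Import all_boot all_order all_algebra.
From mathcomp Require Import boolp reals sequences.
From mathcomp.analysis Require Import exp.
From mathcomp Require Import normedtype derive realfun.
From mathcomp.real_closed Require Import complex.
From mathcomp Require Import ring lra.
Import Order.TTheory GRing.Theory Num.Theory.
Import numFieldNormedType.Exports.
Local Open Scope ring_scope.
Set Implicit Arguments. Unset Strict Implicit. Unset Printing Implicit Defensive.

(** Let [F] be the Fermi-Dirac matrix [fermi beta mu] applied to [H], with
eigenvalues [p i], let [P] be feasible with eigenvalues [q j], and let [W] be
the overlap matrix of the two eigenbases.  As [tr P = tr F], the energy gap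
[E(P) - E(F)] is the sum of [W i j ^ 2 * KL(q j || p i) / beta], where [KL] is
the binary relative entropy, while the quadratic form to be bounded is the sum
of [W i j ^ 2 * max (1 / beta) |l i - mu| * (q j - p i) ^ 2].  So everything
reduces to [KL(q || p) >= max 1 |ln ((1 - p) / p)| * (q - p) ^ 2], a weak form of
the Pinsker and Kearns-Saul inequalities.  It also forces the minimizer of [E]
to be [F].  The [l1] penalty only enters through the comparison of the penalized
energies of the two minimizers. *)

(** * Spectral theorem for real symmetric matrices *)

Lemma mulmx_tr_ge0 (R : realDomainType) n (u : 'rV[R]_n) : 0 <= (u *m u^T) 0 0.
Proof. by rewrite mxE sumr_ge0 // => i _; rewrite mxE -expr2 sqr_ge0. Qed.

Lemma mulmx_tr_eq0 (R : realDomainType) n (u : 'rV[R]_n) :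
  ((u *m u^T) 0 0 == 0) = (u == 0).
Proof.
apply/eqP/eqP => [|->]; last by rewrite mul0mx mxE.
rewrite mxE => /psumr_eq0P u0; apply/rowP => i; rewrite mxE.
have : u 0 i * u^T i 0 = 0 by apply: u0 => // k _; rewrite mxE -expr2 sqr_ge0.
by rewrite mxE => /eqP; rewrite -expr2 sqrf_eq0 => /eqP.
Qed.

(** A complex eigenvector always exists. Symmetry forces its eigenvalue to be real, so its real and
    imaginary parts each satisfy the eigenvector equation, and a nonzero one can be normalized. *)
Lemma symmetric_eigenvector (R : rcfType) n (A : 'M[R]_n) : (0 < n)%N ->
  A^T = A -> exists l (u : 'rV[R]_n), u *m u^T = 1%:M /\ u *m A = l *: u.
Proof.
move=> n0 Asym; have [a] := eigenvalue_closed (map_mx (real_complex R) A) n0.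
case/eigenvalueP => w wA w0.
pose x := map_mx (@complex.Re R) w; pose y := map_mx (@complex.Im R) w.
have xA : x *m A = complex.Re a *: x - complex.Im a *: y.
  apply/rowP => j; have := congr1 (fun v : 'rV_n => complex.Re (v 0 j)) wA.
  rewrite !mxE raddf_sum /= => e; transitivity (complex.Re (a * w 0 j)).
    rewrite -e; apply: eq_bigr => i _; rewrite !mxE.
    by case: (w 0 i) => c d /=; rewrite mulr0 subr0.
  by case: (a) => a1 a2; case: (w 0 j).
have yA : y *m A = complex.Re a *: y + complex.Im a *: x.
  apply/rowP => j; have := congr1 (fun v : 'rV_n => complex.Im (v 0 j)) wA.
  rewrite !mxE raddf_sum /= => e; transitivity (complex.Im (a * w 0 j)).
    rewrite -e; apply: eq_bigr => i _; rewrite !mxE.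
    by case: (w 0 i) => c d /=; rewrite mulr0 add0r.
  by case: (a) => a1 a2; case: (w 0 j).
have xy0 : (x != 0) || (y != 0).
  rewrite -negb_and; apply: contra w0 => /andP[/eqP x0 /eqP y0].
  apply/eqP/rowP => j; move/rowP: x0 => /(_ j); move/rowP: y0 => /(_ j).
  by rewrite !mxE; case: (w 0 j) => c d /= -> ->.
(* Comparing [x A y^T] with its transpose shows that the eigenvalue is real. *)
have a0 : complex.Im a = 0.
  have /eqP : x *m A *m y^T = (x *m A *m y^T)^T.
    by apply/matrixP => i j; rewrite !ord1 [RHS]mxE.
  rewrite [X in _ == X]trmx_mul trmxK trmx_mul Asym mulmxA xA yA.
  rewrite mulmxBl mulmxDl -!scalemxAl.
  have -> : x *m y^T = y *m x^T.
    by rewrite -[RHS]trmxK trmx_mul trmxK; apply/matrixP => i j;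
      rewrite !ord1 [RHS]mxE.
  rewrite (inj_eq (addrI _)) eq_sym -subr_eq0 opprK -scalerDr => /eqP.
  move/(congr1 (fun M : 'M_1 => M 0 0)); rewrite mxE [X in _ * X]mxE.
  rewrite [RHS]mxE => /eqP; rewrite mulf_eq0 => /orP[/eqP//|].
  rewrite paddr_eq0 ?mulmx_tr_ge0// !mulmx_tr_eq0 => /andP[x0 y0].
  by rewrite x0 y0 in xy0.
have [v v0 vA] : exists2 v : 'rV_n, v != 0 & v *m A = complex.Re a *: v.
  case/orP: xy0 => ?; [exists x | exists y] => //.
    by rewrite xA a0 scale0r subr0.
  by rewrite yA a0 scale0r addr0.
have v2_gt0 : 0 < (v *m v^T) 0 0 by rewrite lt_def mulmx_tr_eq0 v0 mulmx_tr_ge0.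
exists (complex.Re a), ((Num.sqrt ((v *m v^T) 0 0))^-1 *: v); split; last first.
  by rewrite -scalemxAl vA !scalerA mulrC.
rewrite linearZ /= -scalemxAr -scalemxAl scalerA -invfM -expr2 sqr_sqrtr ?ltW//.
by rewrite [X in _ *: X]mx11_scalar scale_scalar_mx mulVf ?gt_eqF.
Qed.

(** For [u != v], [Q] is the reflection in the hyperplane orthogonal to [u - v], which exchanges the
    two unit vectors. *)
Lemma householder (R : rcfType) n (u v : 'rV[R]_n) :
  u *m u^T = 1%:M -> v *m v^T = 1%:M ->
  exists Q : 'M_n, [/\ Q^T = Q, Q *m Q = 1%:M & v *m Q = u].
Proof.
move=> uu vv; have [->|uv] := eqVneq u v.
  by exists 1%:M; rewrite trmx1 !mulmx1.
pose w := u - v; pose c := (w *m w^T) 0 0.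
have c0 : c != 0 by rewrite mulmx_tr_eq0 subr_eq0.
have wwE : w *m w^T = c%:M by rewrite [LHS]mx11_scalar.
have vu : v *m u^T = u *m v^T.
  by rewrite -[LHS]trmxK trmx_mul trmxK; apply/matrixP => i j;
      rewrite !ord1 [LHS]mxE.
(* As [u] and [v] are unit vectors, [c = 2 - 2 <u, v>] while [<v, w> = <u, v> - 1]; the reflection
   therefore adds exactly [w] to [v]. *)
have vw : v *m w^T = (- (c / 2))%:M.
  have uvE : u *m v^T = ((u *m v^T) 0 0)%:M by rewrite [LHS]mx11_scalar.
  rewrite /c /w linearB /= mulmxBr !mulmxBl !mulmxBr uu vv vu uvE.
  by rewrite -!raddfB !mxE /=; congr (_%:M); field.
have wE : v + w = u by rewrite addrC subrK.
clearbody c w; exists (1%:M - (2 / c) *: (w^T *m w)); split.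
- by rewrite linearB /= trmx1 linearZ /= trmx_mul trmxK.
- rewrite mulmxBl mul1mx mulmxBr mulmx1 -scalemxAl -scalemxAr scalerA.
  rewrite -mulmxA [w *m (_ *m _)]mulmxA wwE mul_scalar_mx -scalemxAr scalerA.
  rewrite -addrA -[RHS]addr0; congr (_ + _); rewrite opprB addrC -!addrA.
  rewrite -!scaleNr -!scalerDl.
  by rewrite [X in X *: _](_ : _ = 0) ?scale0r// /GRing.scale /=; field.
rewrite mulmxBr mulmx1 -scalemxAr mulmxA vw mul_scalar_mx scalerA.
rewrite [X in X *: _](_ : _ = -1); last by field.
by rewrite scaleN1r opprK.
Qed.

(** Deflation: a reflection taking the first basis vector to a unit eigenvector conjugates [A] to a
    matrix whose first row is [l *: e]. By symmetry this matrix is block diagonal, and induction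
    applies to the lower block. *)
Lemma spectral_theorem (R : realType) n (A : 'M[R]_n) : A^T = A ->
  exists Ud : 'M[R]_n * 'rV[R]_n, spec_decomp A Ud.1 Ud.2.
Proof.
elim: n A => [|n IHn] A Asym.
  by exists (0, 0); split; apply/matrixP => -[].
have [l [u [uu uA]]] := symmetric_eigenvector (ltn0Sn n) Asym.
pose e := delta_mx 0 0 : 'rV[R]_n.+1.
have ee : e *m e^T = 1%:M.
  by rewrite trmx_delta mul_delta_mx; apply/matrixP => i j; rewrite !ord1 !mxE.
have [Q [Qsym QQ eQ]] := householder uu ee.
pose B : 'M_(1 + n) := Q *m A *m Q.
have Bsym : B^T = B by rewrite !trmx_mul Qsym Asym mulmxA.
have Brow : row 0 B = l *: e.
  by rewrite rowE !mulmxA -/e eQ uA -scalemxAl -eQ -mulmxA QQ mulmx1.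
have -> : A = Q *m B *m Q by rewrite !mulmxA QQ mul1mx -mulmxA QQ mulmx1.
clearbody B; have Bblock : B = block_mx l%:M 0 0 (drsubmx B).
  have Brow0 j : B 0 j = l * (j == 0)%:R.
    by have /rowP/(_ j) := Brow; rewrite [LHS]mxE => ->; rewrite !mxE eqxx.
  have Bur : ursubmx B = 0.
    apply/matrixP => i j; rewrite ord1 2!mxE [in RHS]mxE lshift0 Brow0.
    by rewrite -val_eqE /= mulr0.
  have Bul : ulsubmx B = l%:M.
    apply/matrixP => i j; rewrite !ord1 2!mxE [in RHS]mxE !lshift0 Brow0.
    by rewrite !eqxx mulr1.
  rewrite -[LHS]submxK Bul Bur; congr block_mx.
  by rewrite -{1}Bsym -trmx_ursub Bur trmx0.
have [|[V d] /= [VV BV]] := IHn (drsubmx B).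
  by rewrite -[in RHS]Bsym -trmx_drsub.
pose V1 : 'M_(1 + n) := block_mx 1%:M 0 0 V.
have V1V1 : V1 *m V1^T = 1%:M.
  rewrite tr_block_mx mulmx_block !trmx0 trmx1 !mulmx0 !mul0mx mulmx1 VV.
  by rewrite !addr0 add0r -scalar_mx_block.
have V1E : block_mx l%:M 0 0 (V *m diag_mx d *m V^T) =
    V1 *m diag_mx (row_mx l%:M d) *m V1^T :> 'M_(1 + n).
  have -> : diag_mx (row_mx l%:M d) = block_mx l%:M 0 0 (diag_mx d) :> 'M_(1 + n).
    rewrite diag_mx_row; congr block_mx.
    by apply/matrixP => i j; rewrite !ord1 !mxE.
  rewrite tr_block_mx !mulmx_block !trmx0 trmx1.
  by rewrite !(mulmx0, mul0mx, mul1mx, mulmx1, addr0, add0r).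
exists (Q *m V1, row_mx l%:M d); split => /=.
  by rewrite trmx_mul -mulmxA [V1 *m _]mulmxA V1V1 mul1mx Qsym QQ.
by rewrite trmx_mul Qsym Bblock BV V1E !mulmxA.
Qed.

(** The decomposition is chosen before [f]: one eigenbasis serves all functions of the same
    matrix. *)
Lemma mxfun_spectral (R : realType) n (A : 'M[R]_n) : A^T = A ->
  exists U d, spec_decomp A U d /\
    forall f, mxfun f A = U *m diag_mx (map_mx f d) *m U^T.
Proof.
move=> /spectral_theorem; rewrite /mxfun; case: pselect => // h _.
by exists (sval (cid h)).1, (sval (cid h)).2; split; [exact: (svalP (cid h))|].
Qed.

(** * Binary relative entropy *)

Lemma MVT01 (R : realType) (f df : R -> R) (a b : R) :
  (forall x : R, 0 < x < 1 -> is_derive x 1 f (df x)) -> 0 < a -> a <= b -> b < 1 ->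
  exists2 c, a <= c <= b & f b - f a = df c * (b - a).
Proof.
move=> fdf a0 ab b1.
have [||c] := @MVT_segment R f df a b ab.
- by move=> x; rewrite in_itv /= => /andP[ax xb]; apply: fdf; lra.
- apply: derivable_within_continuous => x; rewrite in_itv /= => /andP[ax xb].
  have x01 : 0 < x < 1 by lra.
  by have := fdf x x01 => ?; apply: ex_derive.
by rewrite in_itv /=; exists c.
Qed.

(** Signs are required only between [p] and [q], so one statement covers moving away from [p] in
    either direction. *)
Lemma le_of_derive_away (R : realType) (f df : R -> R) (p q : R) :
  (forall x : R, 0 < x < 1 -> is_derive x 1 f (df x)) ->
  0 < p < 1 -> 0 < q < 1 ->
  (forall x, p <= x <= q -> 0 <= df x) ->
  (forall x, q <= x <= p -> df x <= 0) -> f p <= f q.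
Proof.
move=> fdf /andP[p0 p1] /andP[q0 q1] df_ge0 df_le0; rewrite -subr_ge0.
case: (leP p q) => [pq|/ltW qp].
  have [c /df_ge0 c0 ->] := MVT01 fdf p0 pq q1.
  by rewrite mulr_ge0 // subr_ge0.
have [c /df_le0 c0 fE] := MVT01 fdf q0 qp p1.
by rewrite -opprB fE -mulNr mulr_ge0 ?oppr_ge0 ?subr_ge0.
Qed.

Section BinaryEntropy.
Variable R : realType.
Implicit Types p q x : R.

(** Minus the derivative of [binent]. *)
Definition neglogit x : R := ln (1 - x) - ln x.

(** The convention [ln 0 = 0] gives the right values at [q = 0] and [q = 1], where the offending
    logarithm has coefficient zero. *)
Definition binkl q p : R := q * (ln q - ln p) + (1 - q) * (ln (1 - q) - ln (1 - p)).

Lemma neglogitC x : neglogit (1 - x) = - neglogit x.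
Proof. by rewrite /neglogit subKr opprB. Qed.

Lemma binentC x : binent (1 - x) = binent x.
Proof. by rewrite /binent subKr addrC. Qed.

Lemma binklC q p : binkl (1 - q) (1 - p) = binkl q p.
Proof. by rewrite /binkl !subKr addrC. Qed.

(** This exhibits [binkl] as the Bregman divergence of [binent]: the gap between [binent] and its
    tangent at [p]. *)
Lemma binklE q p : binkl q p = binent q - binent p + neglogit p * (q - p).
Proof. by rewrite /binkl /binent /neglogit; ring. Qed.

Lemma is_derive_ln1B x : 0 < x < 1 ->
  is_derive x 1 (fun y => ln (1 - y)) (- (1 - x)^-1).
Proof.
move=> x01; have x1 : 0 < 1 - x by lra.
have lnd := is_derive1_ln x1.
have : is_derive x 1 (@ln R \o (fun y => 1 - y)) ((1 - x)^-1 * (0 - 1)).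
  exact: is_derive1_comp.
by move/is_derive_eq; apply; rewrite sub0r mulrN1.
Qed.

Lemma is_derive_neglogit x : 0 < x < 1 ->
  is_derive x 1 neglogit (- (x * (1 - x))^-1).
Proof.
move=> x01; have x0 : 0 < x by lra.
have lnd := is_derive1_ln x0; have ln1d := is_derive_ln1B x01.
have : is_derive x 1 neglogit (- (1 - x)^-1 - x^-1).
  exact: (@is_deriveB _ _ _ (fun y : R => ln (1 - y)) (@ln R)).
by move/is_derive_eq; apply; field; lra.
Qed.

Lemma is_derive_binent x : 0 < x < 1 -> is_derive x 1 (@binent R) (- neglogit x).
Proof.
move=> x01; have x0 : 0 < x by lra.
have lnd := is_derive1_ln x0; have ln1d := is_derive_ln1B x01.
have xlnd : is_derive x 1 (fun y : R => y * ln y) (x *: x^-1 + ln x *: 1).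
  exact: (@is_deriveM _ _ id (@ln R)).
have xln1d : is_derive x 1 (fun y : R => (1 - y) * ln (1 - y))
    ((1 - x) *: (- (1 - x)^-1) + ln (1 - x) *: (0 - 1)).
  exact: (@is_deriveM _ _ (fun y : R => 1 - y) (fun y : R => ln (1 - y))).
have : is_derive x 1 (@binent R) (x *: x^-1 + ln x *: 1 +
    ((1 - x) *: (- (1 - x)^-1) + ln (1 - x) *: (0 - 1))).
  exact: (@is_deriveD _ _ _ (fun y : R => y * ln y)
                            (fun y : R => (1 - y) * ln (1 - y))).
by move/is_derive_eq; apply; rewrite /neglogit /GRing.scale /=; field; lra.
Qed.

(** Differentiating reduces the comparison to the position of [neglogit] relative to a line. Both
    quadratic lower bounds on [binkl] below are obtained this way. *)
Lemma binentDquad_le (a b c p q : R) : 0 < p < 1 -> 0 < q < 1 ->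
  (forall x, p <= x <= q -> a * neglogit x <= b + 2 * c * x) ->
  (forall x, q <= x <= p -> b + 2 * c * x <= a * neglogit x) ->
  a * binent p + (b * p + c * p ^+ 2) <= a * binent q + (b * q + c * q ^+ 2).
Proof.
move=> p01 q01 up down.
apply: (le_of_derive_away (f := fun x => a * binent x + (b * x + c * x ^+ 2))
          (df := fun x => b + 2 * c * x - a * neglogit x)) => // x.
- move=> x01; have bd := is_derive_binent x01.
  have abd : is_derive x 1 (fun y : R => a * binent y) (a *: - neglogit x).
    exact: (@is_deriveZ _ _ _ (@binent R)).
  have quadd : is_derive x 1 (fun y : R => b * y + c * y ^+ 2) (b + 2 * c * x).
    have bd' : is_derive x 1 (fun y : R => b * y) (b *: 1).
      exact: (@is_deriveZ _ _ _ id).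
    have sqrd : is_derive x 1 (fun y : R => y ^+ 2) (x *: 1 + x *: 1).
      exact: (@is_deriveM _ _ id id).
    have csqrd : is_derive x 1 (fun y : R => c * y ^+ 2) (c *: (x *: 1 + x *: 1)).
      exact: (@is_deriveZ _ _ _ (fun y : R => y ^+ 2)).
    have : is_derive x 1 (fun y : R => b * y + c * y ^+ 2)
        (b *: 1 + c *: (x *: 1 + x *: 1)).
      exact: (@is_deriveD _ _ _ (fun y : R => b * y) (fun y : R => c * y ^+ 2)).
    by move/is_derive_eq; apply; rewrite /GRing.scale /=; ring.
  have : is_derive x 1 (fun y : R => a * binent y + (b * y + c * y ^+ 2))
      (a *: - neglogit x + (b + 2 * c * x)).
    exact: (@is_deriveD _ _ _ (fun y : R => a * binent y)).
  by move/is_derive_eq; apply; rewrite /GRing.scale /=; ring.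
- by move/up; rewrite subr_ge0.
- by move/down; rewrite subr_le0.
Qed.

(** The derivative of [ln] is at least 1 on [(0, 1]]; the proof uses only [ln (1 + x) <= x] at
    [x = p / q - 1]. *)
Lemma ln_sub_ge p q : 0 < p -> p <= q -> q <= 1 -> q - p <= ln q - ln p.
Proof.
move=> p0 pq q1; have q0 : 0 < q by lra.
have : ln (p / q) <= p / q - 1.
  have := @le_ln1Dx R (p / q - 1); rewrite [1 + _]addrC subrK; apply.
  by have : 0 < p / q; [exact: divr_gt0 | lra].
rewrite ln_div ?posrE// => lnpq.
have : q - p <= (q - p) / q by rewrite ler_pdivlMr// ler_piMr// subr_ge0.
rewrite mulrBl divff ?gt_eqF//; lra.
Qed.

Lemma sqr_le_binkl p q : 0 < p < 1 -> 0 < q < 1 -> (q - p) ^+ 2 <= binkl q p.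
Proof.
move=> p01 q01.
(* Up to a constant, this function of [x] is [binkl x p - (x - p) ^ 2]. Its monotonicity away from
   [p] follows from [ln_sub_ge] applied to both logarithms. *)
have : 1 * binent p + ((neglogit p + 2 * p) * p + (-1) * p ^+ 2) <=
       1 * binent q + ((neglogit p + 2 * p) * q + (-1) * q ^+ 2).
  apply: binentDquad_le => // x /andP[x1 x2]; rewrite /neglogit.
    have := @ln_sub_ge p x; have := @ln_sub_ge (1 - x) (1 - p); lra.
  have := @ln_sub_ge x p; have := @ln_sub_ge (1 - p) (1 - x); lra.
rewrite binklE; nra.
Qed.

(* [neglogit] is convex on [(0, 1/2]] and vanishes at [1/2]. *)
Lemma neglogit_star p q : 0 < p -> p <= q -> q <= 2^-1 ->
  (1 - 2 * p) * neglogit q <= (1 - 2 * q) * neglogit p.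
Proof.
move=> p0 pq q2.
have half1 : (2^-1 : R) < 1 by lra.
have q1 : q < 1 by lra.
(* Convexity enters as a comparison of mean slopes on [[p, q]] and [[q, 1/2]]: [x (1 - x)] increases
   up to [1/2], so the first slope is the steeper. *)
have [c /andP[pc cq] cE] := MVT01 is_derive_neglogit p0 pq q1.
have [d /andP[qd d2] dE] := MVT01 is_derive_neglogit (lt_le_trans p0 pq) q2 half1.
have neglogit_half : neglogit 2^-1 = 0.
  by rewrite /neglogit (_ : 1 - 2^-1 = 2^-1) ?subrr//; lra.
have cd : (d * (1 - d))^-1 <= (c * (1 - c))^-1.
  by rewrite lef_pV2 ?posrE; nra.
move: dE cE; rewrite neglogit_half; set k := _^-1 in cd *.
set k' := (c * _)^-1 in cd *.
move=> dE cE.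
have -> : neglogit q = k * (2^-1 - q) by lra.
have -> : neglogit p = k * (2^-1 - q) + k' * (q - p) by lra.
have : 0 <= (2^-1 - q) * (q - p) by rewrite mulr_ge0 ?subr_ge0.
nra.
Qed.

(* Tight form of the Kearns-Saul inequality: by [neglogit_star], the symmetric
   function [(1 - 2 p) binent x + neglogit p * x (1 - x)] has minima at [p] and
   [1 - p]. *)
Lemma kearns_saul p q : 0 < p <= 2^-1 -> 0 < q < 1 ->
  neglogit p * (q - p) ^+ 2 <= (1 - 2 * p) * binkl q p.
Proof.
move=> /andP[p0 p2] q01.
pose Phi x := (1 - 2 * p) * binent x + (neglogit p * x + (- neglogit p) * x ^+ 2).
have PhiC x : Phi (1 - x) = Phi x by rewrite /Phi binentC; ring.
(* [Phi q - Phi p] is exactly the difference of the two sides. *)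
suff : Phi p <= Phi q by rewrite binklE /Phi; nra.
wlog q2 : q q01 / q <= 2^-1.
  move=> wlg; case: (leP q 2^-1) => [|q2]; first exact: wlg.
  by rewrite -[Phi q]PhiC; apply: wlg; lra.
apply: binentDquad_le => //; first lra; move=> x /andP[x1 x2].
  by have := @neglogit_star p x p0 x1; lra.
by have := @neglogit_star x p; lra.
Qed.

(** The reflection [x -> 1 - x] allows [p <= 1/2], where [neglogit p >= 0]. Differentiation handles
    only [0 < q < 1], so the two endpoints are checked directly. *)
Lemma binkl_ge p q : 0 < p < 1 -> 0 <= q <= 1 ->
  Num.max 1 `|neglogit p| * (q - p) ^+ 2 <= binkl q p.
Proof.
wlog p2 : p q / p <= 2^-1.
  move=> wlg p01 q01; case: (leP p 2^-1) => [|p2]; first by move/wlg; apply.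
  have := wlg (1 - p) (1 - q); rewrite neglogitC binklC normrN.
  rewrite (_ : 1 - q - (1 - p) = - (q - p)); last by ring.
  by rewrite sqrrN; apply; lra.
move=> p01 /andP[q0 q1].
have lp_ge0 : 0 <= neglogit p.
  by rewrite subr_ge0 ler_ln ?posrE; lra.
rewrite ger0_norm// /Num.max.
have lnp : - ln p <= p^-1 - 1.
  have := @le_ln1Dx R (p^-1 - 1); rewrite [1 + _]addrC subrK lnV ?posrE; last by lra.
  by apply; have : 0 < p^-1; [rewrite invr_gt0; lra | lra].
have ln1p : p <= - ln (1 - p).
  by have := @ln_sub_ge (1 - p) 1; rewrite ln1; lra.
have lnp1 : 1 - p <= - ln p by have := @ln_sub_ge p 1; rewrite ln1; lra.
(* At [q = 0] the right side is [- ln (1 - p) >= p], and [neglogit p * p <= 1] bounds the left side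
   by [p]. *)
have [->|q_neq0] := eqVneq q 0.
  rewrite /binkl mul0r subr0 ln1 sub0r sqrrN add0r mul1r sub0r.
  have : neglogit p * p <= 1.
    have : p^-1 * p = 1 by rewrite mulVf//; lra.
    by rewrite /neglogit; nra.
  by case: ifP => _ ?; nra.
have [->|q_neq1] := eqVneq q 1.
  rewrite /binkl subrr mul0r ln1 addr0 mul1r sub0r.
  have : neglogit p <= - ln p by rewrite /neglogit; lra.
  have p1 : (1 - p) ^+ 2 <= 1 - p by nra.
  case: ifP => _ lpp; last by rewrite mul1r; lra.
  have : neglogit p * (1 - p) ^+ 2 <= neglogit p * 1 by rewrite ler_wpM2l//; lra.
  lra.
have q01 : 0 < q < 1 by rewrite lt_def q_neq0 q0 lt_neqAle q_neq1.
case: ifP => _; last by rewrite mul1r sqr_le_binkl.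
(* The factor [1 - 2 * p] in [kearns_saul] is at most 1 and [binkl q p] is nonnegative. *)
have p02 : 0 < p <= 2^-1 by lra.
have := kearns_saul p02 q01; have := sqr_le_binkl p01 q01.
have := sqr_ge0 (q - p); nra.
Qed.

Lemma fermi_itv beta mu x : 0 < fermi beta mu x < 1.
Proof.
rewrite invr_gt0 invf_lt1; have := expR_gt0 (beta * (x - mu)); lra.
Qed.

(** The stationarity condition: at the Fermi-Dirac occupation the slope of the entropy cancels the
    energy relative to [mu]. *)
Lemma neglogit_fermi beta mu x : neglogit (fermi beta mu x) = beta * (x - mu).
Proof.
have e0 := expR_gt0 (beta * (x - mu)); have /andP[f0 _] := fermi_itv beta mu x.
rewrite /neglogit.
have -> : 1 - fermi beta mu x = expR (beta * (x - mu)) * fermi beta mu x :> R.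
  by rewrite /fermi; field; lra.
by rewrite lnM ?posrE// expRK addrK.
Qed.

Lemma binkl_fermi_ge beta mu x q : 0 < beta -> 0 <= q <= 1 ->
  Num.max beta^-1 `|x - mu| * (q - fermi beta mu x) ^+ 2 <=
    beta^-1 * binkl q (fermi beta mu x).
Proof.
move=> b0 q01; have := binkl_ge (fermi_itv beta mu x) q01.
rewrite neglogit_fermi normrM gtr0_norm// => h.
have -> : Num.max beta^-1 `|x - mu| = beta^-1 * Num.max 1 (beta * `|x - mu|).
  by rewrite maxr_pMr ?invr_ge0 ?ltW// mulr1 mulKf ?gt_eqF.
by rewrite -mulrA ler_pM2l ?invr_gt0.
Qed.

End BinaryEntropy.

(** * Energy gap *)

Section SpectralTraces.
Variables (R : realFieldType) (n : nat).
Implicit Types (U V W A : 'M[R]_n) (a b : 'rV[R]_n).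

Lemma orthogonal_overlap U V : U *m U^T = 1%:M -> V *m V^T = 1%:M ->
  (U^T *m V) *m (U^T *m V)^T = 1%:M.
Proof.
move=> UU VV; rewrite trmx_mul trmxK mulmxA -[_ *m V *m _]mulmxA VV mulmx1.
exact: mulmx1C.
Qed.

(** With the column version, this makes the squared overlaps doubly stochastic, so a sum over either
    spectrum spreads over pairs of eigenvalues. *)
Lemma orthogonal_row_sum W i : W *m W^T = 1%:M -> \sum_j W i j ^+ 2 = 1.
Proof.
move=> WW; transitivity ((W *m W^T) i i); last by rewrite WW mxE eqxx.
by rewrite mxE; apply: eq_bigr => j _; rewrite mxE expr2.
Qed.

Lemma orthogonal_col_sum W j : W *m W^T = 1%:M -> \sum_i W i j ^+ 2 = 1.
Proof.
move=> /mulmx1C WW; rewrite -[RHS](@orthogonal_row_sum W^T j) ?trmxK//.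
by apply: eq_bigr => i _; rewrite mxE.
Qed.

Lemma mxtrace_diag_mul a A : \tr (diag_mx a *m A) = \sum_i a 0 i * A i i.
Proof. by apply: eq_bigr => i _; rewrite mul_diag_mx mxE. Qed.

Lemma mxtrace_spectral U a : U *m U^T = 1%:M ->
  \tr (U *m diag_mx a *m U^T) = \sum_i a 0 i.
Proof. by move=> /mulmx1C UU; rewrite mxtrace_mulC mulmxA UU mul1mx mxtrace_diag. Qed.

Lemma mxtrace_spectral_mul U V a b :
  \tr ((U *m diag_mx a *m U^T) *m (V *m diag_mx b *m V^T)) =
  \sum_i \sum_j a 0 i * b 0 j * (U^T *m V) i j ^+ 2.
Proof.
rewrite -!mulmxA mxtrace_mulC -!mulmxA mxtrace_diag_mul; apply: eq_bigr => i _.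
rewrite mulmxA [in X in _ * X]mulmxA -[V^T *m U]trmxK trmx_mul trmxK.
rewrite mxE mulr_sumr; apply: eq_bigr => j _.
by rewrite mul_mx_diag !mxE; ring.
Qed.

(** Inserting [V *m V^T] between the two factors [A] produces squared entries in mixed bases. For
    [A = Q - F] these entries are eigenvalue differences times overlaps. *)
Lemma mxtrace_spectral_sqr U a V A : U *m U^T = 1%:M -> V *m V^T = 1%:M ->
  A^T = A ->
  \tr ((U *m diag_mx a *m U^T) *m (A *m A)) =
  \sum_i \sum_j a 0 i * (U^T *m A *m V) i j ^+ 2.
Proof.
move=> UU VV Asym.
have -> : A *m A = (A *m V) *m (A *m V)^T.
  by rewrite trmx_mul Asym mulmxA -[A *m V *m _]mulmxA VV mulmx1.
rewrite -!mulmxA mxtrace_mulC -!mulmxA mxtrace_diag_mul; apply: eq_bigr => i _.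
rewrite !mulmxA -[_ *m A *m V *m _ *m U]mulmxA -[X in _ *m X]trmxK.
rewrite [(_ *m U)^T]trmx_mul trmxK mulmxA.
by rewrite mxE mulr_sumr; apply: eq_bigr => j _; rewrite [(_ ^T) j i]mxE expr2.
Qed.

End SpectralTraces.

(** * Positive semidefiniteness and feasibility through eigenvalues *)

Lemma psd_spectral (R : realType) n (U : 'M[R]_n) d : U *m U^T = 1%:M ->
  psd (U *m diag_mx d *m U^T) <-> forall i, 0 <= d 0 i.
Proof.
move=> UU; have quad (v : 'cV[R]_n) :
    (v^T *m (U *m diag_mx d *m U^T) *m v) 0 0 = \sum_i d 0 i * (U^T *m v) i 0 ^+ 2.
  have -> : v^T *m (U *m diag_mx d *m U^T) *m v =
      (U^T *m v)^T *m (diag_mx d *m (U^T *m v)).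
    by rewrite trmx_mul trmxK !mulmxA.
  rewrite mxE; apply: eq_bigr => i _.
  by rewrite mul_diag_mx [(_ ^T) _ _]mxE [X in _ * X]mxE; ring.
split=> [psdA i|d_ge0 v]; last first.
  by rewrite quad sumr_ge0 // => i _; rewrite mulr_ge0 ?sqr_ge0.
(* The test vector is the [i]-th eigenvector, which isolates [d 0 i]. *)
have := psdA (U *m delta_mx i 0); rewrite quad mulmxA (mulmx1C UU) mul1mx.
rewrite (bigD1 i) //= mxE !eqxx expr1n mulr1 big1 ?addr0 // => j /negbTE ji.
by rewrite mxE ji expr0n mulr0.
Qed.

Lemma spectral_1B (R : realType) n (U : 'M[R]_n) d : U *m U^T = 1%:M ->
  1%:M - U *m diag_mx d *m U^T = U *m diag_mx (map_mx (fun x => 1 - x) d) *m U^T.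
Proof.
move=> UU; have -> : diag_mx (map_mx (fun x => 1 - x) d) = 1%:M - diag_mx d.
  apply/matrixP => i j; rewrite !mxE.
  by case: eqP => _; rewrite ?subrr ?mulr1n ?mulr0n ?subrr.
by rewrite mulmxBr mulmx1 mulmxBl UU.
Qed.

Lemma psd_1B_spectral (R : realType) n (U : 'M[R]_n) d : U *m U^T = 1%:M ->
  psd (1%:M - U *m diag_mx d *m U^T) <-> forall i, d 0 i <= 1.
Proof.
move=> UU; rewrite spectral_1B //.
by split=> [/(psd_spectral _ UU)|] h; [|apply/psd_spectral => //] => i;
  move: (h i); rewrite !mxE subr_ge0.
Qed.

Lemma fermi_feasible (R : realType) n (H : 'M[R]_n) N beta mu : H^T = H ->
  \tr (mxfun (fermi beta mu) H) = N%:R -> feasible N (mxfun (fermi beta mu) H).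
Proof.
move=> /mxfun_spectral[U [l [[UU _] ->]]] trN; split=> //; split.
  by rewrite !trmx_mul trmxK tr_diag_mx mulmxA.
split; [apply/psd_spectral => // i|apply/psd_1B_spectral => // i];
  by rewrite mxE; have /andP[/ltW ? /ltW ?] := fermi_itv beta mu (l 0 i).
Qed.

(* [mxfun] need not choose the same eigenbasis for [F] as for [H], so the
   entropy of [F] is first replaced by [E0], written with the eigenvalues of [H];
   the gap formula applied to [P = F] then shows that [E0] is the energy of [F]. *)
Lemma free_energy_gap (R : realType) n (H : 'M[R]_n) N beta mu P :
  H^T = H -> 0 < beta ->
  let F := mxfun (fermi beta mu) H in \tr F = N%:R -> feasible N P ->
  \tr (mxfun (fun x => Num.max beta^-1 `|x - mu|) H *m ((P - F) *m (P - F)))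
    <= Ebeta H beta P - Ebeta H beta F
  /\ (Ebeta H beta P <= Ebeta H beta F -> P = F).
Proof.
move=> Hsym b0 F trN Pf; have FF := fermi_feasible Hsym trN.
have [U [l [[UU HE] HfE]]] := mxfun_spectral Hsym.
pose p := map_mx (fermi beta mu) l.
have FE : F = U *m diag_mx p *m U^T by rewrite /F HfE.
pose g i := Num.max beta^-1 `|l 0 i - mu|.
pose E0 := \sum_i (l 0 i * p 0 i + beta^-1 * binent (p 0 i)).
have gap Q : feasible N Q -> exists V q, [/\ spec_decomp Q V q,
    Ebeta H beta Q - E0 =
      \sum_i \sum_j beta^-1 * binkl (q 0 j) (p 0 i) * (U^T *m V) i j ^+ 2,
    \tr (mxfun (fun x => Num.max beta^-1 `|x - mu|) H *m ((Q - F) *m (Q - F))) =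
      \sum_i \sum_j g i * (q 0 j - p 0 i) ^+ 2 * (U^T *m V) i j ^+ 2
    & forall i j, (U^T *m (Q - F) *m V) i j = (q 0 j - p 0 i) * (U^T *m V) i j].
  move=> [trQ [Qsym [Qpos Q1]]].
  have [V [q [[VV QE] QfE]]] := mxfun_spectral Qsym.
  have WW := orthogonal_overlap UU VV.
  have WE i j : (U^T *m (Q - F) *m V) i j = (q 0 j - p 0 i) * (U^T *m V) i j.
    have -> : U^T *m (Q - F) *m V = U^T *m V *m diag_mx q - diag_mx p *m (U^T *m V).
      rewrite mulmxBr mulmxBl QE FE !mulmxA -(mulmxA _ V^T V) (mulmx1C VV) mulmx1.
      by rewrite (mulmx1C UU) mul1mx.
    by rewrite mxE mul_mx_diag [X in _ + X]mxE mul_diag_mx !mxE; ring.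
  exists V, q; split=> //; last first.
    have QFsym : (Q - F)^T = Q - F.
      by case: FF => _ [Fsym _]; rewrite linearB /= Qsym Fsym.
    rewrite HfE (mxtrace_spectral_sqr _ UU VV QFsym).
    apply: eq_bigr => i _; apply: eq_bigr => j _.
    by rewrite WE mxE exprMn mulrA.
  have row_sum (f : 'I_n -> R) : \sum_i f i = \sum_i \sum_j f i * (U^T *m V) i j ^+ 2.
    by apply: eq_bigr => i _; rewrite -mulr_sumr orthogonal_row_sum// mulr1.
  have col_sum (f : 'I_n -> R) : \sum_j f j = \sum_i \sum_j f j * (U^T *m V) i j ^+ 2.
    rewrite exchange_big; apply: eq_bigr => j _.
    by rewrite -mulr_sumr orthogonal_col_sum// mulr1.
  have tr0 : \sum_i \sum_j (q 0 j - p 0 i) * (U^T *m V) i j ^+ 2 = 0.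
    transitivity (\tr Q - \tr F); last by rewrite trQ trN subrr.
    rewrite QE FE !mxtrace_spectral // [\sum_i q 0 i]col_sum.
    rewrite [\sum_i p 0 i]row_sum -sumrB.
    by apply: eq_bigr => i _; rewrite -sumrB; apply: eq_bigr => j _; rewrite mulrBl.
  (* Subtracting [mu] times the vanishing trace difference turns [l 0 i] into [l 0 i - mu], the
     linear coefficient of [binkl] up to [beta]. *)
  transitivity (Ebeta H beta Q - E0 -
      mu * \sum_i \sum_j (q 0 j - p 0 i) * (U^T *m V) i j ^+ 2).
    by rewrite tr0 mulr0 subr0.
  rewrite /Ebeta QfE mxtrace_spectral // {1}HE {1}QE mxtrace_spectral_mul.
  rewrite [\sum_i (map_mx _ q) 0 i]col_sum [E0]row_sum.
  rewrite !mulr_sumr -big_split -!sumrB /=.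
  apply: eq_bigr => i _; rewrite !mulr_sumr -big_split -!sumrB /=.
  apply: eq_bigr => j _; rewrite !mxE binklE neglogit_fermi.
  by field; rewrite gt_eqF.
have bounds Q V q : feasible N Q -> spec_decomp Q V q -> forall j, 0 <= q 0 j <= 1.
  move=> [_ [_ [Qpos Q1]]] [VV QE] j; rewrite QE in Qpos Q1.
  by rewrite (psd_spectral q VV).1// (psd_1B_spectral q VV).1.
have eqF Q V q : spec_decomp Q V q ->
    (forall i j, (U^T *m (Q - F) *m V) i j = 0) -> Q = F.
  move=> [VV QE] UQV0; apply/eqP; rewrite -subr_eq0; apply/eqP.
  have : U *m (U^T *m (Q - F) *m V) *m V^T = 0.
    rewrite [X in U *m X](_ : _ = 0) ?mulmx0 ?mul0mx//.
    by apply/matrixP => i j; rewrite UQV0 mxE.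
  by rewrite !mulmxA UU mul1mx -mulmxA VV mulmx1.
have le_gap Q : feasible N Q ->
    \tr (mxfun (fun x => Num.max beta^-1 `|x - mu|) H *m ((Q - F) *m (Q - F)))
    <= Ebeta H beta Q - E0.
  move=> Qf; have [V [q [QVq -> -> _]]] := gap Q Qf.
  apply: ler_sum => i _; apply: ler_sum => j _.
  rewrite ler_wpM2r ?sqr_ge0// /g !mxE binkl_fermi_ge//.
  exact: bounds Qf QVq j.
have E0E : Ebeta H beta F = E0.
  have [V [q [FVq gapF _ WE]]] := gap F FF.
  apply/eqP; rewrite -subr_eq0 gapF; apply/eqP.
  apply: big1 => i _; apply: big1 => j _.
  (* Even if the two eigenbases differ, a nonzero overlap forces equal eigenvalues, so every term of
     the gap vanishes. *)
  have := WE i j; rewrite subrr mulmx0 mul0mx [LHS]mxE => /esym/eqP.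
  rewrite mulf_eq0 subr_eq0.
  by case/orP => /eqP ->; rewrite ?expr0n ?mulr0// binklE !subrr mulr0 addr0 mulr0 mul0r.
rewrite E0E; split; [exact: le_gap|rewrite -subr_le0 => E_le].
have [V [q [PVq _ trE WE]]] := gap P Pf.
(* The weights are at least [beta^-1], so a nonpositive gap forces every term of the quadratic form,
   and hence [P - F] in mixed bases, to vanish. *)
have g_gt0 i : 0 < g i by rewrite lt_max invr_gt0 b0.
have term_ge0 i j : 0 <= g i * (q 0 j - p 0 i) ^+ 2 * (U^T *m V) i j ^+ 2.
  by rewrite mulr_ge0 ?sqr_ge0 // mulr_ge0 ?sqr_ge0 // ltW.
have /eqP sum0 : \sum_i \sum_j g i * (q 0 j - p 0 i) ^+ 2 * (U^T *m V) i j ^+ 2 == 0.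
  rewrite eq_le -{1}trE (le_trans (le_gap P Pf))//=.
  by apply: sumr_ge0 => i _; apply: sumr_ge0.
apply: (eqF P V q PVq) => i j; rewrite WE.
have /psumr_eq0P rows0 := sum0.
have : \sum_j g i * (q 0 j - p 0 i) ^+ 2 * (U^T *m V) i j ^+ 2 = 0.
  by apply: rows0 => // k _; apply: sumr_ge0.
move/psumr_eq0P => /(_ (fun _ _ => term_ge0 _ _) j isT) /eqP.
by rewrite -mulrA -exprMn mulf_eq0 gt_eqF//= sqrf_eq0 => /eqP.
Qed.

Theorem theorem2 (R : realType) (n : nat) (H : 'M[R]_n) (N : nat)
  (beta eta mu : R) (Pinf Peta : 'M[R]_n) :
  H^T = H -> (0 < N)%N -> 0 < beta -> 0 < eta ->
  \tr (mxfun (fermi beta mu) H) = N%:R ->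
  is_minimizer (Ebeta H beta) N Pinf ->
  is_minimizer (fun P => Ebeta H beta P + eta^-1 * l1norm P) N Peta ->
  (0 <= Ebeta H beta Peta - Ebeta H beta Pinf
   /\ Ebeta H beta Peta - Ebeta H beta Pinf <= eta^-1 * l1norm Pinf)
  /\ \tr (mxfun (fun x => Num.max beta^-1 `|x - mu|) H
          *m ((Peta - Pinf) *m (Peta - Pinf))) <= eta^-1 * l1norm Pinf.
Proof.
move=> Hsym _ b0 eta0 trN [Pinf_f Pinf_min] [Peta_f Peta_min].
have upper : Ebeta H beta Peta - Ebeta H beta Pinf <= eta^-1 * l1norm Pinf.
  have := Peta_min _ Pinf_f.
  have : 0 <= eta^-1 * l1norm Peta.
    apply: mulr_ge0; first by rewrite invr_ge0 ltW.
    by apply: sumr_ge0 => i _; apply: sumr_ge0.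
  lra.
split; first by rewrite subr_ge0 Pinf_min.
(* Minimality against the feasible Fermi-Dirac matrix triggers the equality case of the gap
   bound. *)
have PinfE : Pinf = mxfun (fermi beta mu) H.
  apply: (free_energy_gap Hsym b0 trN Pinf_f).2.
  by apply: Pinf_min; exact: fermi_feasible.
apply: le_trans upper; rewrite PinfE.
exact: (free_energy_gap Hsym b0 trN Peta_f).1.
Qed.
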